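(* Let $g:\mathbb{R}\to\mathbb{R}$ be non-decreasing and left continuous, let $a,b\in\mathbb{R}$ with $a<b$, and let $1\leqslant p<\infty$. The embedding of $W_g^{1,1}([a,b))$ into $L^p_g([a,b))$ is compact.
   Context: $\mathbb{F}$ is $\mathbb{R}$ or $\mathbb{C}$; all functions are $\mathbb{F}$-valued. $\mu_g$ is the Lebesgue–Stieltjes measure of $g$, with $\mu_g([x,y))=g(y)-g(x)$, and $L^p_g(I)$ is the $L^p$ space of $\mu_g$ on $I$. The Stieltjes–Sobolev space is $$W_g^{1,1}([a,b))=\Big\{u\in L^1_g([a,b)):\ \exists\,\widetilde u\in L^1_g([a,b)),\ u(x)=u(a)+\int_{[a,x)}\widetilde u(s)\,\mathrm{d}\mu_g(s)\ \ \forall x\in[a,b]\Big\},$$ its elements being regarded as functions on $[a,b]$ satisfying this identity, with norm $\|u\|_{W_g^{1,1}}=\|u\|_{L^1_g([a,b))}+\|\widetilde u\|_{L^1_g([a,b))}$. *)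

(* Defs.v *)
From HB Require Import structures.
From mathcomp Require Import all_boot all_order all_algebra.
From mathcomp Require Import all_classical all_reals all_analysis.
From mathcomp Require Import complex.

Set Implicit Arguments.
Unset Strict Implicit.
Unset Printing Implicit Defensive.
Import Order.TTheory GRing.Theory Num.Theory.
Import numFieldNormedType.Exports.

Local Open Scope classical_set_scope.
Local Open Scope ring_scope.

(* A left-continuous function is turned into a right-continuous one by        *)
(* x |-> - g (- x), whose library Lebesgue-Stieltjes measure (normalised on   *)
(* left-open intervals) is transported back along x |-> - x. The result is    *)
(* the Borel measure with mu_g [x, y[ = g y - g x, see stieltjes_measure_itv. *)
Section stieltjes_measure.
Context (R : realType) (g : R -> R).
Hypothesis g_nd : nondecreasing g.
Hypothesis g_lc : forall x, g @ x^'- --> g x.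

Definition reflection (x : R) : R := - g (- x).

Lemma reflection_nondecreasing : nondecreasing reflection.
Proof. by move=> x y xy; rewrite lerN2; apply: g_nd; rewrite lerN2. Qed.

Lemma reflection_right_continuous : right_continuous reflection.
Proof.
move=> x; apply: (@cvgN _ R^o); have /cvg_at_leftNP := g_lc (x := - x).
by rewrite opprK.
Qed.

Definition reflection_cumulative : cumulative R R :=
  HB.pack reflection (@isCumulative.Build R _ R reflection
    reflection_nondecreasing reflection_right_continuous).

Let measurable_opp : measurable_fun [set: measurableTypeR R]
  (-%R : measurableTypeR R -> measurableTypeR R).
Proof. by []. Qed.

Definition stieltjes_measure : {measure set (measurableTypeR R) -> \bar R} :=
  measure_function_pushforward__canonical__measure_function_Measure
    (lebesgue_stieltjes_measure reflection_cumulative) measurable_opp.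

Lemma stieltjes_measure_itv (x y : R) : x <= y ->
  stieltjes_measure `[x, y[%classic = (g y - g x)%:E.
Proof.
move=> xy; rewrite /stieltjes_measure/= /pushforward.
rewrite opp_preimage_itvbndbnd/= /lebesgue_stieltjes_measure /measure_extension.
rewrite measurable_mu_extE/=; last exact: is_ocitv.
by rewrite wlength_itv_bnd ?lerN2//= /reflection !opprK addrC.
Qed.

End stieltjes_measure.

(* The scalar field F is either R or its complexification R[i].               *)
Variant scalar_kind := RealScalars | ComplexScalars.

Definition scalars (R : realType) (k : scalar_kind) : numFieldType :=
  match k with RealScalars => R | ComplexScalars => R[i] end.

Definition re_part (R : realType) (k : scalar_kind) : scalars R k -> R :=
  match k return scalars R k -> R with
  | RealScalars => id
  | ComplexScalars => @complex.Re R
  end.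

Definition im_part (R : realType) (k : scalar_kind) : scalars R k -> R :=
  match k return scalars R k -> R with
  | RealScalars => fun=> 0
  | ComplexScalars => @complex.Im R
  end.

Definition of_parts (R : realType) (k : scalar_kind) : R -> R -> scalars R k :=
  match k return R -> R -> scalars R k with
  | RealScalars => fun x _ => x
  | ComplexScalars => fun x y => Complex x y
  end.

(* [`|z|] has type [scalars R k]; its real part is the modulus as an element  *)
(* of R.                                                                      *)
Definition modulus (R : realType) (k : scalar_kind) (z : scalars R k) : R :=
  re_part `|z|.

(* Functions are total on R; a function on a set D is represented by any of   *)
(* its extensions, and the notions below only depend on values on D. As usual *)
(* in the library, classes modulo a.e. equality are replaced by functions and *)
(* norms by the corresponding seminorms.                                      *)
Section function_spaces.
Context (R : realType) (k : scalar_kind).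
Variable mu : {measure set (measurableTypeR R) -> \bar R}.
Implicit Types (D : set (measurableTypeR R)) (u v : R -> scalars R k).

Definition scalar_measurable D u : Prop :=
  measurable_fun D (fun x => re_part (u x)) /\
  measurable_fun D (fun x => im_part (u x)).

Definition scalar_integral D u : scalars R k :=
  of_parts k (\int[mu]_(s in D) re_part (u s))
             (\int[mu]_(s in D) im_part (u s)).

Definition Lp_norm D (p : R) u : \bar R :=
  'N[mu]_(p%:E)[EFin \o ((fun x => modulus (u x)) \_ D)].

Definition Lp D (p : R) : set (R -> scalars R k) :=
  [set u | scalar_measurable D u /\ (Lp_norm D p u < +oo)%E].

Definition stieltjes_derivative_of (a b : R) u v : Prop :=
  Lp `[a, b[ 1 v /\
  forall x, x \in `[a, b] -> u x = u a + scalar_integral `[a, x[ v.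

Definition W11 (a b : R) : set (R -> scalars R k) :=
  [set u | Lp `[a, b[ 1 u /\ exists v, stieltjes_derivative_of a b u v].

(* The derivative is unique up to mu-a.e. equality on [a, b[, so that the     *)
(* choice made here does not affect W11_norm.                                 *)
Definition stieltjes_derivative (a b : R) u : R -> scalars R k :=
  xget (fun=> 0) [set v | stieltjes_derivative_of a b u v].

Definition W11_norm (a b : R) u : \bar R :=
  (Lp_norm `[a, b[ 1 u + Lp_norm `[a, b[ 1 (stieltjes_derivative a b u))%E.

End function_spaces.

(* Compact embedding of the (semi)normed space (X, NX) into (Y, NY): X is     *)
(* contained in Y with bounded inclusion, and every bounded sequence of X has *)
(* a subsequence which converges in Y.                                        *)
Definition compactly_embedded (R : realType) (V : zmodType)
    (X : set V) (NX : V -> \bar R) (Y : set V) (NY : V -> \bar R) : Prop :=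
  [/\ X `<=` Y,
      exists C : R, forall u, X u -> (NY u <= C%:E * NX u)%E
    & forall u : nat -> V, (forall n, X (u n)) ->
        (exists M : R, forall n, (NX (u n) <= M%:E)%E) ->
        exists phi : nat -> nat, increasing_seq phi /\
          exists2 v, Y v & NY (u (phi n) - v) @[n --> \oo] --> 0%E].

(* Main.v *)
Require Import Defs.
From mathcomp Require Import all_boot all_order all_algebra.
From mathcomp Require Import all_classical all_reals all_analysis.
From mathcomp Require Import complex.
From mathcomp Require Import measurable_realfun lra.

Set Implicit Arguments.
Unset Strict Implicit.
Unset Printing Implicit Defensive.
Import Order.TTheory GRing.Theory Num.Theory.
Import numFieldNormedType.Exports.

Local Open Scope classical_set_scope.
Local Open Scope ring_scope.

(* A sequence u_n bounded in W^{1,1}_g is bounded in sup norm, because its    *)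
(* oscillation is at most the L^1 norm of the derivative v_n and its mean is  *)
(* bounded; its increments are dominated by those of the nondecreasing        *)
(* functions V_n(x) = int_[a,x[ |v_n|. Helly's argument then gives a          *)
(* subsequence which converges at every point of [a, b], and dominated        *)
(* convergence for the finite measure mu_g on [a, b[ gives convergence in     *)
(* L^p. For the Helly step, limits V and u are first taken along an           *)
(* ultrafilter; a subsequence which attains them on the countable set formed  *)
(* by the rationals, the endpoints and the discontinuities of V converges     *)
(* everywhere. When mu_g([a, b[) = 0 all the norms vanish.                    *)

(** Everything rests on domination. Each coordinate of u_n has increments bounded by those of the
    nondecreasing primitive of |v_n| ([coord_increment_le]), and averaging over [a, b[ turns this
    into a sup bound by the norm ([coord_sup_le]). As the measure of [a, b[ is finite, the sup bound
    already gives the inclusion into L^p and its continuity ([W11_embedding_bound]). For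
    subsequences, [dominated_helly] is Helly's selection theorem for sequences controlled by
    monotone functions: away from the jumps of the limit of the controlling functions, convergence
    at nearby points of a countable set forces convergence. The extracted sequence is uniformly
    bounded and converges at every point of [a, b], so bounded convergence ([Lp_norm_cvg0]) makes it
    converge in L^p. *)

Lemma ultra_fmap (S T : Type) (f : S -> T) (F : set_system S) :
  UltraFilter F -> UltraFilter (f @ F).
Proof.
move=> FU; split=> [|G GF sFG]; first exact: fmap_proper_filter.
rewrite eqEsubset; split=> // A GA.
have [//|FnA] := in_ultra_setVsetC (f @^-1` A) FU.
have : G (A `&` ~` A) by apply: filterI => //; exact: sFG.
by move=> /filter_ex[x []].
Qed.

Lemma bounded_ultra_cvg (R : realType) (T : Type) (F : set_system T)
    (f : T -> R) (K : R) :
  UltraFilter F -> (forall t, `|f t| <= K) -> exists l : R, f @ F --> l.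
Proof.
move=> FU fK; have /= := @segment_compact R (- K) K.
rewrite compact_ultra => /(_ (f @ F) (ultra_fmap f FU)) [].
  by apply: (@filterE _ F) => t /=; rewrite in_itv/= -ler_norml.
by move=> l [_ fl]; exists l.
Qed.

Lemma cvg_increasing_seq (phi : nat -> nat) :
  increasing_seq phi -> phi @ \oo --> \oo.
Proof.
move=> /increasing_seqP phi_incr; apply/cvgnyPge => A; exists A => // n /= An.
apply: leq_trans An _; elim: n => // n ih.
exact: leq_ltn_trans ih (phi_incr n).
Qed.

(** A diagonal extraction: closeness at finitely many indices t holds on a set of [F], and [F]
    contains all tails, so this set has arbitrarily large elements, among which the next term is
    chosen. *)
Lemma filter_cvg_subseq (R : realType) (T : countType) (F : set_system nat)
    (g : T -> nat -> R) (l : T -> R) :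
  ProperFilter F -> \oo `<=` F -> (forall t, g t @ F --> l t) ->
  exists phi : nat -> nat, increasing_seq phi /\
    forall t, g t (phi n) @[n --> \oo] --> l t.
Proof.
move=> PF ooF gl.
(* The tolerance k is kept apart from the number m of indices so that the induction on m, a finite
   intersection in [F], leaves it fixed. *)
have near_l (k m : nat) : F [set n | forall t, (pickle t < m)%N ->
    `|l t - g t n| < k.+1%:R^-1].
  elim: m => [|m ih]; first exact: nearW.
  have [[t tm]|nm] := pselect (exists t : T, pickle t = m); last first.
    apply: filterS ih => n nk t; rewrite ltnS leq_eqVlt => /predU1P[tm|].
      by exfalso; apply: nm; exists t.
    exact: nk.
  have k0 : 0 < k.+1%:R^-1 :> R by rewrite invr_gt0.
  have /cvgr_dist_lt /(_ _ k0) glt := gl t.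
  apply: filterS (filterI ih glt) => n [nk ntk] s.
  rewrite ltnS leq_eqVlt => /predU1P[sm|]; last exact: nk.
  suff -> : s = t by [].
  by apply: (pcan_inj (@pickleK T)); rewrite sm tm.
have /choice[c cP] : forall Nk : nat * nat, exists n, (Nk.1 < n)%N /\
    forall t, (pickle t < Nk.2)%N -> `|l t - g t n| < Nk.2.+1%:R^-1.
  move=> [N k]; have FN : F [set n | (N < n)%N] by apply: ooF; exists N.+1.
  by have [n [nN nk]] := filter_ex (filterI FN (near_l k k)); exists n.
(* The term of rank n is close at the indices of code below n; at rank 0 this requires nothing, so
   the starting value is arbitrary. *)
pose phi := fix phi n := if n is m.+1 then c (phi m, n) else c (0%N, 0%N).
have phi_close n t : (pickle t < n)%N -> `|l t - g t (phi n)| < n.+1%:R^-1.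
  by case: n => // n; exact: (cP (phi n, n.+1)).2.
exists phi; split.
  by apply/increasing_seqP => n; exact: (cP (phi n, n.+1)).1.
move=> t; apply/cvgrPdist_lt => e e0; near=> n.
apply: lt_trans (phi_close n t _) _; first by near: n; exact: nbhs_infty_gt.
near: n; exact: near_infty_natSinv_lt (PosNum e0).
Unshelve. all: end_near. Qed.

(** * Helly selection for dominated sequences *)

Lemma countable_setU (T : Type) (A B : set T) :
  countable A -> countable B -> countable (A `|` B).
Proof.
move=> cA cB; have -> : A `|` B = \bigcup_(i : bool) (if i then A else B).
  apply/seteqP; split=> [x [Ax|Bx]|x [[] _ ?]].
  - by exists true.
  - by exists false.
  - by left.
  - by right.
by apply: bigcup_countable => [|[]]; first exact: countableP.
Qed.

(** A monotone function has countably many jumps. Outside the jumps and the endpoints, both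
    one-sided limits at x agree, so F varies by less than e between some y0 < x < y1, hence also
    between rationals q in ]y0, x[ and q' in ]x, y1[. *)
Lemma nondecreasing_continuity_gap (R : realType) (a b : R) (F : R -> R) :
  {in `[a, b] &, nondecreasing_fun F} ->
  exists2 C : set R, countable C & forall x, x \in `[a, b] -> ~ C x ->
    forall e, 0 < e -> exists d d', [/\ C d, C d', a <= d <= x, x <= d' <= b
      & F d' - F d < e].
Proof.
move=> ndF.
have nd u v : a <= u -> u <= v -> v <= b -> F u <= F v.
  move=> au uv vb; apply: ndF => //; rewrite in_itv/=.
    by rewrite au (le_trans uv).
  by rewrite vb (le_trans au).
pose D := [set x | x \in (`]a, b[) /\ discontinuity F x].
exists ([set a; b] `|` range (@ratr R) `|` D).
  apply: countable_setU; last exact: discontinuity_countable.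
  apply: countable_setU; first exact: finite_set_countable.
  by apply: sub_countable (card_image_le _ _) _; exact: countableP.
move=> x; rewrite in_itv/= => /andP[ax xb] nCx e e0.
have {}ax : a < x.
  rewrite lt_neqAle ax andbT; apply: contra_notN nCx => /eqP <-.
  by left; left; left.
have {}xb : x < b.
  rewrite lt_neqAle xb andbT; apply: contra_notN nCx => /eqP ->.
  by left; left; right.
have cvgl : cvg (F y @[y --> x^'-]).
  apply: nondecreasing_at_left_is_cvgr; near=> y.
    have ay : a < y by near: y; exact: nbhs_left_gt.
    move=> u v; rewrite !in_itv/= => /andP[yu ux] /andP[yv vx] uv.
    by apply: nd => //; lra.
  have ay : a < y by near: y; exact: nbhs_left_gt.
  exists (F x) => _ [u /= + <-]; rewrite in_itv/= => /andP[yu ux].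
  by apply: nd; lra.
have cvgr : cvg (F y @[y --> x^'+]).
  apply: nondecreasing_at_right_is_cvgr; near=> y.
    have yb : y < b by near: y; exact: nbhs_right_lt.
    move=> u v; rewrite !in_itv/= => /andP[yu ux] /andP[yv vx] uv.
    by apply: nd => //; lra.
  have yb : y < b by near: y; exact: nbhs_right_lt.
  exists (F x) => _ [u /= + <-]; rewrite in_itv/= => /andP[yu ux].
  by apply: nd; lra.
have e2 : 0 < e / 2 by rewrite divr_gt0.
have lr : lim (F y @[y --> x^'-]) = lim (F y @[y --> x^'+]).
  apply: contra_notP nCx => /eqP lr; right; split=> //.
  by rewrite in_itv/= ax xb.
have [y0 [ay yx Fy]] : exists y, [/\ a < y, y < x &
    `|lim (F y @[y --> x^'-]) - F y| < e / 2].
  move/cvgrPdist_lt : cvgl => /(_ _ e2) Fl.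
  suff : \forall y \near x^'-, [/\ a < y, y < x &
    `|lim (F y @[y --> x^'-]) - F y| < e / 2] by exact: filter_ex.
  near=> y; split; near: y => //; first exact: nbhs_left_gt.
  exact: nbhs_left_lt.
have [y1 [xy' y'b Fy']] : exists y, [/\ x < y, y < b &
    `|lim (F y @[y --> x^'+]) - F y| < e / 2].
  move/cvgrPdist_lt : cvgr => /(_ _ e2) Fl.
  suff : \forall y \near x^'+, [/\ x < y, y < b &
    `|lim (F y @[y --> x^'+]) - F y| < e / 2] by exact: filter_ex.
  near=> y; split; near: y => //; last exact: nbhs_right_lt.
  exact: nbhs_right_gt.
have [q] := rat_in_itvoo yx; rewrite in_itv/= => /andP[yq qx].
have [q'] := rat_in_itvoo xy'; rewrite in_itv/= => /andP[xq' q'y'].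
exists (ratr q), (ratr q'); split.
- by left; right; exists q.
- by left; right; exists q'.
- by apply/andP; split; lra.
- by apply/andP; split; lra.
have Fyq : F y0 <= F (ratr q) by apply: nd; lra.
have Fqy' : F (ratr q') <= F y1 by apply: nd; lra.
by move: Fy Fy'; rewrite lr !ltr_norml => /andP[? ?] /andP[? ?]; lra.
Unshelve. all: end_near. Qed.

(** All bounded sequences converge along one ultrafilter, so limits VU and F exist on all of [a, b]
    before any extraction, and the domination passes to them. Thus VU is nondecreasing and
    determines a countable set C, on which a subsequence is made to converge; elsewhere f is
    squeezed by the small variation of V between two points of C. *)
Lemma dominated_helly (R : realType) (a b K : R) (V f : nat -> R -> R) :
  a <= b ->
  (forall n x, x \in `[a, b] -> `|V n x| <= K /\ `|f n x| <= K) ->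
  (forall n x y, a <= x -> x <= y -> y <= b ->
    `|f n y - f n x| <= V n y - V n x) ->
  exists phi : nat -> nat, increasing_seq phi /\
    exists F : R -> R, forall x, x \in `[a, b] ->
      f (phi n) x @[n --> \oo] --> F x.
Proof.
move=> ab bnd dom.
have [U [UU ooU]] := ultraFilterLemma (@eventually_filter).
have lim_ex (h : nat -> R -> R) :
    (forall n x, x \in `[a, b] -> `|h n x| <= K) ->
    exists H : R -> R, forall x, x \in `[a, b] -> h n x @[n --> U] --> H x.
  move=> hK; suff /choice[H HP] : forall x, exists l : R, x \in `[a, b] ->
      h n x @[n --> U] --> l by exists H.
  move=> x; have [xab|nxab] := boolP (x \in `[a, b]).
    have [l hl] := bounded_ultra_cvg UU (fun n => hK n x xab).
    by exists l.
  by exists 0.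
have [VU VUP] := lim_ex V (fun n x xab => (bnd n x xab).1).
have [F FP] := lim_ex f (fun n x xab => (bnd n x xab).2).
have domU x y : a <= x -> x <= y -> y <= b -> `|F y - F x| <= VU y - VU x.
  move=> ax xy yb.
  have xab : x \in `[a, b] by rewrite in_itv/= ax (le_trans xy).
  have yab : y \in `[a, b] by rewrite in_itv/= yb (le_trans ax).
  apply: (@ler_cvg_to _ U _ _ (fun n => `|f n y - f n x|)
    (fun n => V n y - V n x)).
  - by apply: cvg_norm; apply: cvgB; exact: FP.
  - by apply: cvgB; exact: VUP.
  - by apply: nearW => n; exact: dom.
have VU_nd : {in `[a, b] &, nondecreasing_fun VU}.
  move=> x y /itvP xab /itvP yab xy; rewrite -subr_ge0.
  by apply: le_trans (domU x y _ _ _); rewrite ?xab ?yab.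
have [C /countable_injP[i i_inj] gap] := nondecreasing_continuity_gap VU_nd.
(* [e] enumerates the points of [C] lying in [a, b]. *)
pose e (j : nat) : R := xget a [set x | [/\ C x, x \in `[a, b] & i x = j]].
(* The default [a] keeps every [e j] in [a, b], where the limits along U are known. *)
have e_ab j : e j \in `[a, b].
  rewrite /e; case: xgetP => [x _ []//|_].
  by rewrite in_itv/= lexx ab.
have e_onto x : C x -> x \in `[a, b] -> exists j, e j = x.
  move=> Cx xab; exists (i x); rewrite /e; case: xgetP => [y _ [Cy _ iyx]|].
    by apply: i_inj; rewrite ?inE.
  by move=> /(_ x)[].
(* The boolean index lets a single subsequence serve both V and f. *)
pose g (t : bool * nat) (n : nat) := if t.1 then V n (e t.2) else f n (e t.2).
pose l (t : bool * nat) := if t.1 then VU (e t.2) else F (e t.2).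
have [|phi [phi_incr phiP]] := @filter_cvg_subseq _ _ U g l _ ooU.
  by move=> [[|] j]; [exact: VUP|exact: FP].
have V_cvg x : C x -> x \in `[a, b] -> V (phi n) x @[n --> \oo] --> VU x.
  by move=> Cx xab; have [j <-] := e_onto x Cx xab; exact: (phiP (true, j)).
have f_cvg x : C x -> x \in `[a, b] -> f (phi n) x @[n --> \oo] --> F x.
  by move=> Cx xab; have [j <-] := e_onto x Cx xab; exact: (phiP (false, j)).
exists phi; split=> //; exists F => x xab.
have [Cx|nCx] := pselect (C x); first exact: f_cvg.
apply/cvgrPdist_lt => eps eps0.
(* |F x - F d| costs one fifth, by the gap of VU; |F d - f d| costs one; |f d - f x| is at most V d'
   - V d, which costs three: the gap of VU and the errors of V at d and d'. *)
have eps5 : 0 < eps / 5 by rewrite divr_gt0.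
have [d [d' [Cd Cd' /andP[ad dx] /andP[xd' d'b] gap_d]]] :=
  gap x xab nCx _ eps5.
have d_ab : d \in `[a, b].
  by rewrite in_itv/= ad (le_trans dx)// (le_trans xd').
have d'_ab : d' \in `[a, b].
  by rewrite in_itv/= d'b (le_trans _ xd')// (le_trans ad).
have /cvgrPdist_lt/(_ _ eps5) Vd := V_cvg d Cd d_ab.
have /cvgrPdist_lt/(_ _ eps5) Vd' := V_cvg d' Cd' d'_ab.
have /cvgrPdist_lt/(_ _ eps5) fd := f_cvg d Cd d_ab.
near=> n.
have Vdn : `|VU d - V (phi n) d| < eps / 5 by near: n.
have Vdn' : `|VU d' - V (phi n) d'| < eps / 5 by near: n.
have fdn : `|F d - f (phi n) d| < eps / 5 by near: n.
have xb : x <= b by exact: le_trans d'b.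
have ax : a <= x by exact: le_trans dx.
have Fdx := domU d x ad dx xb.
have VUxd' := le_trans (normr_ge0 _) (domU x d' ax xd' d'b).
have fdx := dom (phi n) d x ad dx xb.
have Vxd' := le_trans (normr_ge0 _) (dom (phi n) x d' ax xd' d'b).
move: Vdn Vdn' fdn Fdx fdx; rewrite !ltr_norml !ler_norml.
by move=> /andP[? ?] /andP[? ?] /andP[? ?] /andP[? ?] /andP[? ?]; lra.
Unshelve. all: end_near. Qed.

(** * Powers of null sequences, and real coordinates of scalars *)

Lemma powR_cvg0_seq (R : realType) (r : R) (t : nat -> R) :
  0 < r -> (forall n, 0 <= t n) ->
  t n @[n --> \oo] --> 0 -> t n `^ r @[n --> \oo] --> 0.
Proof.
move=> r0 t0 /cvgrPdist_lt tl; apply/cvgrPdist_lt => e e0.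
have e'0 : 0 < e `^ r^-1 by rewrite powR_gt0.
apply: filterS (tl _ e'0) => n; rewrite !sub0r !normrN.
rewrite !ger0_norm ?powR_ge0// => te.
have -> : e = (e `^ r^-1) `^ r by rewrite -powRrM mulVf ?powRr1 ?gt_eqF// ltW.
by rewrite gt0_ltr_powR ?nnegrE ?powR_ge0.
Qed.

(** Indexing the two parts by a boolean treats both scalar fields at once and reduces the estimates
    to real functions; for real scalars the second coordinate is 0. *)
Definition coord (R : realType) (k : scalar_kind) (i : bool) (z : scalars R k)
    : R := if i then re_part z else im_part z.

Section scalar_coordinates.
Context (R : realType) (k : scalar_kind).
Implicit Types (z w : scalars R k) (i : bool).

Lemma coordD i z w : coord i (z + w) = coord i z + coord i w.
Proof.
case: k z w i => /= [z w []|[x y] [x' y'] []] //.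
by rewrite /coord/= addr0.
Qed.

Lemma coordN i z : coord i (- z) = - coord i z.
Proof.
by case: k z i => /= [z []|[x y] []] //; rewrite /coord/= oppr0.
Qed.

Lemma coordB i z w : coord i (z - w) = coord i z - coord i w.
Proof. by rewrite coordD coordN. Qed.

Lemma modulusE z :
  modulus z = Num.sqrt (coord true z ^+ 2 + coord false z ^+ 2).
Proof.
rewrite /modulus; case: k z => /= [z|[]//].
by rewrite /coord/= expr0n addr0 sqrtr_sqr.
Qed.

Lemma modulus_ge0 z : 0 <= modulus z.
Proof. by rewrite modulusE sqrtr_ge0. Qed.

Lemma coord_le_modulus i z : `|coord i z| <= modulus z.
Proof.
rewrite modulusE -sqrtr_sqr; apply: ler_wsqrtr.
by case: i; rewrite ?lerDl ?lerDr sqr_ge0.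
Qed.

Lemma modulus_le z : modulus z <= `|coord true z| + `|coord false z|.
Proof.
rewrite modulusE -[leRHS]ger0_norm ?addr_ge0// -sqrtr_sqr; apply: ler_wsqrtr.
by rewrite sqrrD !real_normK ?num_real// addrAC lerDl mulrn_wge0// mulr_ge0.
Qed.

Lemma modulus_le_coord z K : (forall i, `|coord i z| <= K) ->
  modulus z <= 2 * K.
Proof.
move=> zK; apply: le_trans (modulus_le _) _.
by have := zK true; have := zK false; lra.
Qed.

Lemma cvg_of_parts (T : Type) (F : set_system T) (w : T -> scalars R k)
    (x y : R) : Filter F ->
  coord true (w t) @[t --> F] --> x -> coord false (w t) @[t --> F] --> y ->
  forall i, coord i (w t) @[t --> F] --> coord i (of_parts k x y).
Proof.
by case: k w => /= w FF wx wy [] //; exact: cvg_cst.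
Qed.

Lemma coord_scalar_integral (mu : {measure set (measurableTypeR R) -> \bar R})
    (D : set (measurableTypeR R)) i (v : R -> scalars R k) :
  coord i (scalar_integral mu D v) = (\int[mu]_(s in D) coord i (v s))%R.
Proof.
rewrite /scalar_integral /coord; case: k v i => v []//=.
by rewrite /Rintegral/= integral0.
Qed.

End scalar_coordinates.

(** * The L^p seminorm on a set of finite measure *)

Section Lp_norms.
Context (R : realType) (k : scalar_kind).
Variables (mu : {measure set (measurableTypeR R) -> \bar R}).
Variables (D : set (measurableTypeR R)) (p : R).
Hypotheses (mD : measurable D) (muD : (mu D < +oo)%E) (p1 : 1 <= p).
Implicit Types (u v : R -> scalars R k).

Let p_gt0 : 0 < p. Proof. exact: lt_le_trans p1. Qed.
Let m := fine (mu D).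
Let muDE : mu D = m%:E. Proof. by rewrite fineK// ge0_fin_numE. Qed.

Lemma scalar_measurableP u :
  scalar_measurable D u <-> forall i, measurable_fun D (coord i \o u).
Proof.
split=> [[mre mim] [//|//]|mfu].
by split; [exact: (mfu true)|exact: (mfu false)].
Qed.

Lemma measurable_modulus u : scalar_measurable D u ->
  measurable_fun D (fun x => modulus (u x)).
Proof.
move=> /scalar_measurableP mfu.
under eq_fun do rewrite modulusE.
apply: (@measurableT_comp _ _ _ _ _ _ (@Num.sqrt R)).
  by apply: continuous_measurable_fun => x; exact: sqrt_continuous.
by apply: measurable_funD; apply: measurable_funX; exact: mfu.
Qed.

Lemma scalar_measurableB u v : scalar_measurable D u -> scalar_measurable D v ->
  scalar_measurable D (u - v).
Proof.
move=> /scalar_measurableP mfu /scalar_measurableP mfv.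
apply/scalar_measurableP => i.
rewrite (_ : _ \o _ = (coord i \o u) \- (coord i \o v)).
  exact: measurable_funB.
by apply/funext => x /=; rewrite coordB.
Qed.

Lemma Lp_normE u :
  Lp_norm mu D p u = ((\int[mu]_(x in D) (modulus (u x) `^ p)%:E) `^ p^-1)%E.
Proof.
rewrite /Lp_norm unlock; congr (_ `^ _)%E.
rewrite [RHS]integral_mkcond; apply: eq_integral => x _ /=.
rewrite !patchE; case: ifPn => _ /=.
  by rewrite ger0_norm ?modulus_ge0.
by rewrite normr0 powR0// gt_eqF.
Qed.

Lemma Lp_norm1E u :
  Lp_norm mu D 1 u = (\int[mu]_(x in D) (modulus (u x))%:E)%E.
Proof.
rewrite /Lp_norm Lnorm1 [RHS]integral_mkcond; apply: eq_integral => x _ /=.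
rewrite !patchE; case: ifPn => _ /=; last by rewrite normr0.
by rewrite ger0_norm ?modulus_ge0.
Qed.

Lemma integrable_modulus u : Lp mu D 1 u ->
  mu.-integrable D (EFin \o (fun x => modulus (u x))).
Proof.
move=> [mfu]; rewrite Lp_norm1E => ufin; apply/integrableP; split.
  by apply/measurable_EFinP; exact: measurable_modulus.
apply: le_lt_trans ufin; rewrite le_eqVlt; apply/orP; left; apply/eqP.
by apply: eq_integral => x _ /=; rewrite ger0_norm ?modulus_ge0.
Qed.

Lemma Lp_norm1_Rintegral u : Lp mu D 1 u ->
  Lp_norm mu D 1 u = (\int[mu]_(x in D) modulus (u x))%R%:E.
Proof.
move=> /integrable_modulus/integrable_fin_num; rewrite Lp_norm1E.
by move=> /(_ mD)/fineK <-.
Qed.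

Lemma integrable_coord i u : Lp mu D 1 u ->
  mu.-integrable D (EFin \o (coord i \o u)).
Proof.
move=> Lu; apply: le_integrable (integrable_modulus Lu) => //.
  by apply/measurable_EFinP; case: Lu => /scalar_measurableP + _; exact.
move=> x Dx /=; rewrite lee_fin [leRHS]ger0_norm ?modulus_ge0//.
exact: coord_le_modulus.
Qed.

Lemma Lp_norm_le_bound u K : 0 <= K -> scalar_measurable D u ->
  (forall x, D x -> modulus (u x) <= K) ->
  (Lp_norm mu D p u <= (K * m `^ p^-1)%:E)%E.
Proof.
move=> K0 mfu uK; rewrite Lp_normE.
have m0 : 0 <= m by rewrite fine_ge0.
have -> : (K * m `^ p^-1)%:E = (((K `^ p)%:E * mu D) `^ p^-1)%E.
  rewrite muDE -EFinM poweR_EFin powRM ?powR_ge0//.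
  by rewrite -powRrM mulfV ?powRr1// gt_eqF.
have I0 : (0 <= \int[mu]_(x in D) (modulus (u x) `^ p)%:E)%E.
  by apply: integral_ge0 => x _; rewrite lee_fin powR_ge0.
have KD : (0 <= (K `^ p)%:E * mu D)%E by rewrite mule_ge0// lee_fin powR_ge0.
apply: gt0_ler_poweR; rewrite ?in_itv/= ?leey ?andbT// ?invr_ge0 ?(ltW p_gt0)//.
rewrite -integral_cst//; apply: ge0_le_integral => //.
- by move=> x _; rewrite lee_fin powR_ge0.
- apply/measurable_EFinP; apply: (measurableT_comp (measurable_powR p)).
  exact: measurable_modulus.
- move=> x Dx /=; rewrite lee_fin; have xK := uK x Dx.
  by rewrite ge0_ler_powR ?nnegrE ?modulus_ge0 ?(ltW p_gt0).
Qed.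

Lemma Lp_norm_null u : mu D = 0%E -> scalar_measurable D u ->
  Lp_norm mu D p u = 0%E.
Proof.
move=> D0 mfu; rewrite Lp_normE null_set_integral//.
  by rewrite poweR_EFin powR0// invr_eq0 gt_eqF.
apply/measurable_EFinP; apply: (measurableT_comp (measurable_powR p)).
exact: measurable_modulus.
Qed.

(** Dominated convergence with the constant K^p, which is integrable because D has finite
    measure. *)
Lemma Lp_norm_cvg0 (w : nat -> R -> scalars R k) K :
  (forall n, scalar_measurable D (w n)) ->
  (forall n x, D x -> modulus (w n x) <= K) ->
  (forall i x, D x -> coord i (w n x) @[n --> \oo] --> 0) ->
  Lp_norm mu D p (w n) @[n --> \oo] --> 0%E.
Proof.
move=> mw wK w0.
have mod0 x : D x -> modulus (w n x) @[n --> \oo] --> 0.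
  move=> Dx; apply: (@squeeze_cvgr _ _ _ _ (cst 0)
      (fun n => `|coord true (w n x)| + `|coord false (w n x)|)).
  - by apply: nearW => n; rewrite modulus_ge0 modulus_le.
  - exact: cvg_cst.
  - rewrite -[0 in X in _ --> X]addr0 -[0 in X in X + _](@normr0 _ R)
      -[0 in X in _ + X](@normr0 _ R).
    by apply: cvgD; apply: cvg_norm; exact: w0.
pose f n x := (modulus (w n x) `^ p)%:E.
have mf n : measurable_fun D (f n).
  apply/measurable_EFinP; apply: (measurableT_comp (measurable_powR p)).
  exact: measurable_modulus.
have fK n x : D x -> (`|f n x| <= (K `^ p)%:E)%E.
  move=> Dx; rewrite /f/= lee_fin ger0_norm ?powR_ge0//.
  have wnK := wK n x Dx; have K0 := le_trans (modulus_ge0 _) wnK.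
  by rewrite ge0_ler_powR ?nnegrE ?modulus_ge0 ?(ltW p_gt0).
have iK : mu.-integrable D (cst (K `^ p)%:E).
  apply/integrableP; split=> //; rewrite integral_cst//.
  by rewrite lte_mul_pinfty// ?lee_fin.
have f_int n : mu.-integrable D (f n).
  apply: le_integrable iK => // x Dx; apply: le_trans (fK n x Dx) _.
  by rewrite /= lee_fin ler_norm.
have [] := @dominated_convergence _ _ _ mu D mD f (cst 0%E)
  (cst (K `^ p)%:E) mf.
- exact: measurable_cst.
- apply: aeW => x Dx; apply: (@cvg_EFin R nat \oo).
    by apply: nearW.
  by apply: powR_cvg0_seq => //[n|]; [exact: modulus_ge0|exact: mod0].
- exact: iK.
- by apply: aeW => x n; exact: fK.
move=> _ _; rewrite integral0 => /fine_cvg If.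
have LE n : Lp_norm mu D p (w n) =
    (fine (\int[mu]_(x in D) f n x)%E `^ p^-1)%:E.
  by rewrite Lp_normE -poweR_EFin fineK//; exact: integrable_fin_num.
under eq_fun do rewrite LE; apply: cvg_EFin; first exact: nearW.
apply: powR_cvg0_seq => //; first by rewrite invr_gt0.
move=> n; apply: fine_ge0; apply: integral_ge0 => x _.
by rewrite lee_fin powR_ge0.
Qed.

End Lp_norms.

(** * Pointwise estimates for Stieltjes-Sobolev functions *)

Section stieltjes_sobolev.
Context (R : realType) (k : scalar_kind).
Variables (mu : {measure set (measurableTypeR R) -> \bar R}) (a b : R).
Hypothesis mu_fin : (mu `[a, b[%classic < +oo)%E.
Implicit Types (u v : R -> scalars R k).

Let D : set (measurableTypeR R) := `[a, b[%classic.
Let m := fine (mu D).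
Let mD : measurable D. Proof. exact: measurable_itv. Qed.
Let m_itv (i : interval R) : measurable ([set` i] : set (measurableTypeR R)).
Proof. exact: measurable_itv. Qed.

Lemma Rintegral_co_sub (f : R -> R) (x y : R) :
  mu.-integrable D (EFin \o f) -> a <= x -> x <= y -> y <= b ->
  (\int[mu]_(s in `[a, y[) f s - \int[mu]_(s in `[a, x[) f s =
   \int[mu]_(s in `[x, y[) f s)%R.
Proof.
move=> f_int ax xy yb.
have split_ay : `[a, y[%classic = `[a, x[%classic `|` `[x, y[%classic.
  by rewrite -itv_bndbnd_setU// ?bnd_simp.
rewrite split_ay Rintegral_setU//; first by rewrite addrAC subrr add0r.
  rewrite -split_ay.
  apply: (integrableS mD (m_itv _) _ f_int).
  move=> s; rewrite /D/= !in_itv/= => /andP[-> /lt_le_trans]; exact.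
apply/disj_setPS => s /= []; rewrite !in_itv/= => /andP[_ sx] /andP[xs _].
by move: sx; rewrite ltNge xs.
Qed.

(** The increment of u is the integral of v over [x, y[, and the right-hand side is the integral of
    |v| there. *)
Lemma coord_increment_le u v i (x y : R) : stieltjes_derivative_of mu a b u v ->
  a <= x -> x <= y -> y <= b ->
  `|coord i (u y) - coord i (u x)| <=
  (\int[mu]_(s in `[a, y[) modulus (v s) -
   \int[mu]_(s in `[a, x[) modulus (v s))%R.
Proof.
move=> [Lv uE] ax xy yb.
have v_int := integrable_modulus Lv.
have vi_int := integrable_coord mD i Lv.
have xab : x \in `[a, b] by rewrite in_itv/= ax (le_trans xy).
have yab : y \in `[a, b] by rewrite in_itv/= yb (le_trans ax).
have sub_D : `[x, y[%classic `<=` D.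
  move=> s; rewrite /D/= !in_itv/= => /andP[xs sy].
  by rewrite (le_trans ax)//= (lt_le_trans sy).
rewrite (uE x xab) (uE y yab) !coordD !coord_scalar_integral.
rewrite opprD addrACA subrr add0r Rintegral_co_sub// Rintegral_co_sub//.
have vi_xy : mu.-integrable `[x, y[%classic (EFin \o (coord i \o v)).
  exact: (integrableS mD (m_itv _) _ vi_int).
apply: le_trans (le_normr_Rintegral _ vi_xy) _ => //.
apply: le_Rintegral => //.
- have := integrable_abse vi_xy; exact.
- exact: (integrableS mD (m_itv _) _ v_int).
- by move=> s _; exact: coord_le_modulus.
Qed.

(** For every y in [a, b[, |u x| is at most |u y| plus the integral B of |v|, coordinatewise on the
    left. Integrating in y and dividing by the mass m gives the bound. *)
Lemma coord_sup_le u v i (x : R) : Lp mu D 1 u ->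
  stieltjes_derivative_of mu a b u v -> 0 < m -> x \in `[a, b] ->
  `|coord i (u x)| <=
  (m^-1 * \int[mu]_(s in D) modulus (u s) + \int[mu]_(s in D) modulus (v s))%R.
Proof.
move=> Lu dv m0; rewrite in_itv/= => /andP[ax xb].
set B := (X in _ <= _ + X).
have cst_int (r : R) : mu.-integrable D (EFin \o cst r).
  apply: measurable_bounded_integrable => //.
  by exists `|r|; split=> // M rM s _; exact: ltW.
have pt y : D y -> `|coord i (u x)| <= modulus (u y) + B.
  rewrite /D/= in_itv/= => /andP[ay yb].
  have osc s t : a <= s -> s <= t -> t <= b ->
      `|coord i (u t) - coord i (u s)| <= B.
    move=> sa st tb; apply: le_trans (coord_increment_le i dv sa st tb) _.
    have v_int := integrable_modulus dv.1.
    have V_tb := Rintegral_co_sub v_int (le_trans sa st) tb (lexx b).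
    have ge0 (s' t' : R) : 0 <= (\int[mu]_(r in `[s', t'[) modulus (v r))%R.
      by apply: Rintegral_ge0 => r _; exact: modulus_ge0.
    have := ge0 t b; have := ge0 a s; rewrite -V_tb /B /D; lra.
  rewrite -[coord i (u x)](subrK (coord i (u y))) addrC.
  apply: le_trans (ler_normD _ _) _; apply: lerD; first exact: coord_le_modulus.
  have [xy|/ltW yx] := leP x y; last exact: osc.
  by rewrite distrC; apply: osc => //; exact: ltW.
have u_int := integrable_modulus Lu.
have : (\int[mu]_(s in D) `|coord i (u x)| <=
    \int[mu]_(s in D) (modulus (u s) + B))%R.
  apply: le_Rintegral => //; first exact: cst_int.
  by apply: (integrableD mD u_int (cst_int B)).
rewrite RintegralD//; last exact: cst_int.
rewrite !Rintegral_cst// -/m => le_m.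
rewrite -(ler_pM2l m0) mulrDr mulVKf ?gt_eqF// [m * B]mulrC.
by rewrite [m * _]mulrC.
Qed.

(** Gathers what the compactness argument uses, V being the primitive of the modulus of the chosen
    derivative. The sup bound assumes 0 < m, since constants have norm zero when the mass
    vanishes. *)
Lemma W11_estimates u : W11 mu a b u ->
  exists N (V : R -> R),
  [/\ W11_norm mu a b u = N%:E,
      forall i x y, a <= x -> x <= y -> y <= b ->
        `|coord i (u y) - coord i (u x)| <= V y - V x,
      forall x, x \in `[a, b] -> `|V x| <= N
    & 0 < m -> forall i x, x \in `[a, b] -> `|coord i (u x)| <= (m^-1 + 1) * N].
Proof.
move=> [Lu u'].
have dv : stieltjes_derivative_of mu a b u (stieltjes_derivative mu a b u).
  exact: (xgetPex (fun=> 0) u').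
set v := stieltjes_derivative mu a b u in dv *.
pose A := (\int[mu]_(s in D) modulus (u s))%R.
pose B := (\int[mu]_(s in D) modulus (v s))%R.
have A0 : 0 <= A by apply: Rintegral_ge0 => s _; exact: modulus_ge0.
have B0 : 0 <= B by apply: Rintegral_ge0 => s _; exact: modulus_ge0.
exists (A + B), (fun x => \int[mu]_(s in `[a, x[) modulus (v s))%R; split.
- by rewrite /W11_norm !Lp_norm1_Rintegral//; exact: dv.1.
- by move=> i x y; exact: coord_increment_le.
- move=> x; rewrite in_itv/= => /andP[ax xb].
  have ge0 (s t : R) : 0 <= (\int[mu]_(r in `[s, t[) modulus (v r))%R.
    by apply: Rintegral_ge0 => r _; exact: modulus_ge0.
  have v_int := integrable_modulus dv.1.
  rewrite ger0_norm ?ge0// /B -subr_ge0 -addrA (Rintegral_co_sub v_int ax xb)//.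
  by rewrite addr_ge0 ?ge0.
- move=> m0 i x xab; apply: le_trans (coord_sup_le i Lu dv m0 xab) _.
  have m'0 : 0 <= m^-1 by rewrite invr_ge0 ltW.
  rewrite -/A -/B mulrDl mul1r mulrDr; have := mulr_ge0 m'0 B0; lra.
Qed.

End stieltjes_sobolev.

(** * Boundedness and compactness of the embedding *)

Section compact_embedding.
Context (R : realType) (k : scalar_kind).
Variables (mu : {measure set (measurableTypeR R) -> \bar R}) (a b p : R).
Hypotheses (ab : a <= b) (mu_fin : (mu `[a, b[%classic < +oo)%E) (p1 : 1 <= p).
Implicit Types (u v : R -> scalars R k).

Let D : set (measurableTypeR R) := `[a, b[%classic.
Let m := fine (mu D).
Let mD : measurable D. Proof. exact: measurable_itv. Qed.
Let m_ge0 : 0 <= m. Proof. by rewrite fine_ge0. Qed.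
Let muDE : mu D = m%:E. Proof. by rewrite fineK// ge0_fin_numE. Qed.
Let D_ab x : D x -> x \in `[a, b].
Proof. by rewrite /D/= !in_itv/= => /andP[-> /ltW]. Qed.

Lemma W11_embedding_bound : exists C : R, forall u, W11 mu a b u ->
  (Lp_norm mu D p u <= C%:E * W11_norm mu a b u)%E.
Proof.
move: m_ge0; rewrite le_eqVlt => /predU1P[m0|m_gt0].
  exists 0 => u [Lu _]; rewrite mul0e Lp_norm_null//; last exact: Lu.1.
  by rewrite muDE -m0.
(* The sup bound on each coordinate is (m^-1 + 1) N, two coordinates give the factor 2, and the L^p
   norm of the constant 1 is m^(1/p). *)
exists (2 * (m^-1 + 1) * m `^ p^-1) => u Wu.
have [N [V [-> _ VN uN]]] := W11_estimates mu_fin Wu.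
have N0 : 0 <= N.
  by apply: le_trans (VN a _); rewrite ?normr_ge0// in_itv/= lexx ab.
rewrite -EFinM mulrAC; apply: Lp_norm_le_bound => //; last first.
- move=> x /D_ab xab; rewrite -mulrA; apply: modulus_le_coord => i.
  exact: uN.
- exact: Wu.1.1.
- by rewrite !mulr_ge0// addr_ge0// invr_ge0.
Qed.

Lemma W11_sub_Lp : W11 mu a b `<=` Lp (k := k) mu D p.
Proof.
move=> u Wu; split; first exact: Wu.1.1.
have [C /(_ u Wu) uC] := W11_embedding_bound.
have [N [V [NE _ _ _]]] := W11_estimates mu_fin Wu.
by apply: le_lt_trans uC _; rewrite NE -EFinM ltry.
Qed.

(** Helly is applied to one coordinate, then along the resulting subsequence to the other.
    Convergence at every point, not just almost everywhere, is obtained. *)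
Lemma W11_bounded_cvg_subseq (u : nat -> R -> scalars R k) (M : R) :
  0 < m -> (forall n, W11 mu a b (u n)) ->
  (forall n, (W11_norm mu a b (u n) <= M%:E)%E) ->
  exists K (phi : nat -> nat) v, [/\ increasing_seq phi,
    forall n i x, x \in `[a, b] -> `|coord i (u n x)| <= K
    & forall i x, x \in `[a, b] ->
        coord i (u (phi n) x) @[n --> \oo] --> coord i (v x)].
Proof.
move=> m0 Wu uM.
have /choice[V VP] : forall n, exists V : R -> R, [/\
    forall i x y, a <= x -> x <= y -> y <= b ->
      `|coord i (u n y) - coord i (u n x)| <= V y - V x,
    forall x, x \in `[a, b] -> `|V x| <= (m^-1 + 1) * M
  & forall i x, x \in `[a, b] -> `|coord i (u n x)| <= (m^-1 + 1) * M].
  move=> n; have [N [V [NE dom VN uN]]] := W11_estimates mu_fin (Wu n).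
  have m'0 : 0 <= m^-1 by rewrite invr_ge0.
  have NM : N <= M by rewrite -lee_fin -NE.
  have N0 : 0 <= N.
    by apply: le_trans (VN a _); rewrite ?normr_ge0// in_itv/= lexx ab.
  exists V; split=> //.
    (* [dominated_helly] takes one constant for both sequences, so the bound on V is relaxed by the
       factor m^-1 + 1, which is at least 1. *)
    move=> x xab; apply: le_trans (VN x xab) (le_trans NM _).
    by rewrite ler_peMl ?lerDr// (le_trans N0).
  move=> i x xab; apply: le_trans (uN m0 i x xab) _.
  by rewrite ler_wpM2l// addr_ge0.
set K := (m^-1 + 1) * M in VP.
have bnd i n x : x \in `[a, b] -> `|V n x| <= K /\ `|coord i (u n x)| <= K.
  by move=> xab; have [_ VK uK] := VP n; split; [exact: VK|exact: uK].
have dom i n x y : a <= x -> x <= y -> y <= b ->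
    `|coord i (u n y) - coord i (u n x)| <= V n y - V n x.
  by have [+ _ _] := VP n; exact.
have [phi [phi_incr [F Fcvg]]] := dominated_helly ab (bnd true) (dom true).
have [psi [psi_incr [G Gcvg]]] :=
  dominated_helly ab (fun n => bnd false (phi n)) (fun n => dom false (phi n)).
exists K, (phi \o psi), (fun x => of_parts k (F x) (G x)); split.
- by move=> i j; exact: etrans (phi_incr _ _) (psi_incr _ _).
- by move=> n i x xab; exact: (bnd i n x xab).2.
- move=> i x xab; apply: cvg_of_parts; last exact: Gcvg.
  exact: cvg_comp (cvg_increasing_seq psi_incr) (Fcvg x xab).
Qed.

Theorem W11_compactly_embedded :
  compactly_embedded (W11 mu a b) (W11_norm mu a b)
    (Lp (k := k) mu D p) (Lp_norm mu D p).
Proof.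
split; [exact: W11_sub_Lp|exact: W11_embedding_bound|].
move=> u Wu [M uM].
move: m_ge0; rewrite le_eqVlt => /predU1P[m0|m_gt0].
  (* With zero mass every difference has norm 0, so the whole sequence converges to any of its
     terms. *)
  exists id; split=> //; exists (u 0%N); first exact: W11_sub_Lp.
  under eq_fun => n.
    rewrite Lp_norm_null//; first over.
      by rewrite muDE -m0.
    by apply: scalar_measurableB; exact: (Wu _).1.1.
  exact: cvg_cst.
have [K [phi [v [phi_incr uK uv]]]] := W11_bounded_cvg_subseq m_gt0 Wu uM.
have mu_ n : scalar_measurable D (u n) by exact: (Wu n).1.1.
have mv : scalar_measurable D v.
  apply/scalar_measurableP => i.
  apply: (@measurable_fun_cvg _ _ _ _ (fun n => coord i \o u (phi n))).
    by move=> n; have /scalar_measurableP := mu_ (phi n); exact.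
  by move=> x /D_ab; exact: uv.
have vK i x : x \in `[a, b] -> `|coord i (v x)| <= K.
  move=> xab; apply: (@ler_cvg_to _ \oo _ _
    (fun n => `|coord i (u (phi n) x)|) (cst K)).
  - by apply: cvg_norm; exact: uv.
  - exact: cvg_cst.
  - by apply: nearW => n; exact: uK.
have K0 : 0 <= K.
  by apply: le_trans (vK true a _); rewrite ?normr_ge0// in_itv/= lexx ab.
exists phi; split=> //; exists v.
  split=> //; apply: le_lt_trans (ltry _).
  apply: (@Lp_norm_le_bound _ _ _ _ _ _ _ _ _ (2 * K)) => //.
    by rewrite mulr_ge0.
  by move=> x /D_ab xab; apply: modulus_le_coord => i; exact: vK.
apply: (@Lp_norm_cvg0 _ _ _ _ _ _ _ _ _ (2 * (K + K))) => //.
- by move=> n; exact: scalar_measurableB.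
- move=> n x /D_ab xab; apply: modulus_le_coord => i.
  rewrite coordB; apply: le_trans (ler_normB _ _) _.
  by apply: lerD; [exact: uK|exact: vK].
- move=> i x /D_ab xab.
  under eq_fun do rewrite coordB.
  rewrite -(subrr (coord i (v x))).
  by apply: cvgB; [exact: uv|exact: cvg_cst].
Qed.

End compact_embedding.

Theorem theorem5p18 (R : realType) (k : scalar_kind) (g : R -> R)
    (g_nd : nondecreasing g) (g_lc : forall x, g @ x^'- --> g x)
    (a b p : R) (hab : a < b) (hp : 1 <= p) :
  let mu_g := stieltjes_measure g_nd g_lc in
  @compactly_embedded R (R -> scalars R k)
    (W11 mu_g a b) (W11_norm mu_g a b)
    (Lp mu_g `[a, b[ p) (Lp_norm mu_g `[a, b[ p).
Proof.
apply: W11_compactly_embedded => //; first exact: ltW.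
(* The mass of [a, b[ is the real number g b - g a, hence finite. *)
by rewrite stieltjes_measure_itv ?ltW// ltry.
Qed.
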